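(* Let $\mathcal{P}_4$ be the set of partitions $\lambda=(\lambda_1>\lambda_2>\cdots>\lambda_\ell)$ into distinct positive parts such that for each $1\le i<\ell$: $\lambda_i-\lambda_{i+1}\equiv2\pmod 4$ if $\lambda_i,\lambda_{i+1}$ are both odd; $\lambda_i-\lambda_{i+1}\equiv0\pmod 4$ if they are both even; $\lambda_i-\lambda_{i+1}\equiv3\pmod 4$ if they have different parity; and the smallest part satisfies $\lambda_\ell\equiv1$ or $2\pmod 4$ (the empty partition is included). Let $\mathcal{P}_{4,e}$ and $\mathcal{P}_{4,o}$ be the subsets of $\mathcal{P}_4$ of partitions with an even and odd number of parts, respectively. Then $$\sum_{\lambda\in\mathcal{P}_{4,e}}x^{o(\lambda)}y^{e(\lambda)}q^{|\lambda|}=\sum_{n=0}^{\infty}\frac{(-yq/x;q^2)_{2n}x^{2n}q^{4n^2}}{(q^4;q^4)_{2n}},$$ $$\sum_{\lambda\in\mathcal{P}_{4,o}}x^{o(\lambda)}y^{e(\lambda)}q^{|\lambda|}=\sum_{n=0}^{\infty}\frac{(-yq/x;q^2)_{2n+1}x^{2n+1}q^{4n^2+4n+1}}{(q^4;q^4)_{2n+1}},$$ $$\sum_{\lambda\in\mathcal{P}_4}x^{o(\lambda)}y^{e(\lambda)}q^{|\lambda|}=\sum_{n=0}^{\infty}\frac{(-yq/x;q^2)_{n}x^{n}q^{n^2}}{(q^4;q^4)_{n}}.$$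
   Context: $o(\lambda)$ and $e(\lambda)$ are the numbers of odd and even parts of $\lambda$, $|\lambda|$ is the sum of parts, $(a;q)_n=\prod_{i=0}^{n-1}(1-aq^i)$, and $|q|<1$ (or identities of formal power series). *)

(* Defs.v *)
From HB Require Import structures.
From mathcomp Require Import all_boot all_order all_algebra.
From mathcomp Require Import boolp.

Set Implicit Arguments.
Unset Strict Implicit.
Unset Printing Implicit Defensive.

Import GRing.Theory.
Local Open Scope ring_scope.

Record fps (R : Type) := FPS { coefs : nat -> R }.

HB.instance Definition _ (R : Type) := gen_eqMixin (fps R).
HB.instance Definition _ (R : Type) := gen_choiceMixin (fps R).

Lemma fpsP (R : Type) (f g : fps R) :
  (forall n, coefs f n = coefs g n) -> f = g.
Proof. by case: f g => [f] [g] /= /funext ->. Qed.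

Section FpsRing.
Variable R : comUnitRingType.
Implicit Types f g h : fps R.

Definition fps_zero : fps R := FPS (fun=> 0).
Definition fps_opp f : fps R := FPS (fun n => - coefs f n).
Definition fps_add f g : fps R := FPS (fun n => coefs f n + coefs g n).

Definition fpsC (a : R) : fps R := FPS (fun n => if n == 0%N then a else 0).
Definition fpsX : fps R := FPS (fun n => (n == 1%N)%:R).

Definition fps_mul f g : fps R :=
  FPS (fun n => \sum_(i < n.+1) coefs f i * coefs g (n - i)).

Fact fps_addA : associative fps_add.
Proof. by move=> f g h; apply: fpsP => n /=; rewrite addrA. Qed.
Fact fps_addC : commutative fps_add.
Proof. by move=> f g; apply: fpsP => n /=; rewrite addrC. Qed.
Fact fps_add0 : left_id fps_zero fps_add.
Proof. by move=> f; apply: fpsP => n /=; rewrite add0r. Qed.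
Fact fps_addN : left_inverse fps_zero fps_opp fps_add.
Proof. by move=> f; apply: fpsP => n /=; rewrite addNr. Qed.

HB.instance Definition _ :=
  GRing.isZmodule.Build (fps R) fps_addA fps_addC fps_add0 fps_addN.

Definition fps_trunc N f : {poly R} := \poly_(i < N) coefs f i.

Fact coef_fps_mul N f g n : (n < N)%N ->
  coefs (fps_mul f g) n = (fps_trunc N f * fps_trunc N g)`_n.
Proof.
move=> ltnN; rewrite coefM /=; apply: eq_bigr => i _.
rewrite !coef_poly (leq_ltn_trans _ ltnN) ?(leq_ltn_trans _ ltnN) ?leq_subr //.
by rewrite -ltnS.
Qed.

Fact fps_mulC : commutative fps_mul.
Proof.
by move=> f g; apply: fpsP => n; rewrite !(@coef_fps_mul n.+1) // mulrC.
Qed.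

Fact fps_mulA : associative fps_mul.
Proof.
move=> f g h; apply: fpsP => n.
have tr a b c : coefs (fps_mul a (fps_mul b c)) n =
    (fps_trunc n.+1 a * (fps_trunc n.+1 b * fps_trunc n.+1 c))`_n.
  rewrite (@coef_fps_mul n.+1) // !coefM; apply: eq_bigr => i _; congr (_ * _).
  by rewrite coef_poly ltnS leq_subr (@coef_fps_mul n.+1) // ltnS leq_subr.
by rewrite tr fps_mulC tr mulrA [in RHS]mulrC.
Qed.

Fact fps_mul1 : left_id (fpsC 1) fps_mul.
Proof.
move=> f; apply: fpsP => n /=; rewrite big_ord_recl /= mul1r subn0.
by rewrite big1 ?addr0 // => i _; rewrite mul0r.
Qed.

Fact fps_mulDl : left_distributive fps_mul fps_add.
Proof.
move=> f g h; apply: fpsP => n /=; rewrite -big_split.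
by apply: eq_bigr => i _; rewrite mulrDl.
Qed.

Fact fps_one_neq0 : fpsC 1 != 0.
Proof.
by apply/eqP => /(congr1 (fun f => coefs f 0)) /eqP; rewrite oner_eq0.
Qed.

HB.instance Definition _ := GRing.Zmodule_isComNzRing.Build (fps R)
  fps_mulA fps_mulC fps_mul1 fps_mulDl fps_one_neq0.

(* The first [n] coefficients of [f^-1], by solving [f * g = 1] for [g] one
   coefficient at a time. *)
Fixpoint fps_inv_seq f n : seq R :=
  if n is m.+1 then
    let s := fps_inv_seq f m in
    rcons s ((coefs f 0)^-1 *
      ((m == 0%N)%:R - \sum_(i < m) s`_i * coefs f (m - i)))
  else [::].

Definition fps_unit : {pred fps R} := fun f => coefs f 0 \is a GRing.unit.

(* Following the MathComp convention, [f^-1 = f] if [f] is not invertible. *)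
Definition fps_inv f : fps R :=
  if coefs f 0 \is a GRing.unit then FPS (fun n => (fps_inv_seq f n.+1)`_n)
  else f.

Fact size_fps_inv_seq f n : size (fps_inv_seq f n) = n.
Proof. by elim: n => //= n IHn; rewrite size_rcons IHn. Qed.

Fact nth_fps_inv_seq f n i : (i < n)%N ->
  (fps_inv_seq f n)`_i = (fps_inv_seq f i.+1)`_i.
Proof.
elim: n => // n IHn; rewrite ltnS leq_eqVlt => /predU1P[-> // | ltin].
by rewrite -IHn //= nth_rcons size_fps_inv_seq ltin.
Qed.

Fact fps_mulVx : {in fps_unit, left_inverse 1 fps_inv *%R}.
Proof.
move=> f Uf; rewrite /fps_inv ifT //; apply: fpsP => n.
rewrite [LHS]big_ord_recr.
have -> : coefs (1 : fps R) n = (n == 0%N)%:R by case: n.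
rewrite subnn /= nth_rcons size_fps_inv_seq ltnn eqxx mulrC mulVKr //.
rewrite addrC; apply/eqP; rewrite -addrA eq_sym -subr_eq0 opprD addrA subrr.
rewrite sub0r oppr_eq0 addrC subr_eq0; apply/eqP/eq_bigr => i _.
by rewrite [in RHS]nth_fps_inv_seq.
Qed.

Fact fps_unitPl f g : g * f = 1 -> fps_unit f.
Proof.
move=> /(congr1 (fun h => coefs h 0)) /=; rewrite big_ord1 => gf1.
by apply/unitrP; exists (coefs g 0); split; last rewrite mulrC.
Qed.

Fact fps_inv_out : {in [predC fps_unit], fps_inv =1 id}.
Proof. by move=> f /negPf nUf; rewrite /fps_inv ifF. Qed.

HB.instance Definition _ := GRing.ComNzRing_hasMulInverse.Build (fps R)
  fps_mulVx fps_unitPl fps_inv_out.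

End FpsRing.

Lemma fps_unitE (R : comUnitRingType) (f : fps R) :
  (f \is a GRing.unit) = (coefs f 0 \is a GRing.unit).
Proof. by []. Qed.

(* The unordered sum of [F i] over [i] in [A] converges to [S] for the q-adic
   topology: each coefficient of the finite partial sums is eventually constant
   along the finite subsets of [A] ordered by inclusion. *)
Definition fps_has_sum (R : comUnitRingType) (I : eqType) (A : {pred I})
    (F : I -> fps R) (S : fps R) : Prop :=
  forall N : nat, exists2 s0 : seq I, {subset s0 <= A} &
    forall s : seq I, uniq s -> {subset s <= A} -> {subset s0 <= s} ->
      coefs (\sum_(i <- s) F i) N = coefs S N.

Lemma fps_has_sum_unique (R : comUnitRingType) (I : eqType) (A : {pred I})
    (F : I -> fps R) (S T : fps R) :
  fps_has_sum A F S -> fps_has_sum A F T -> S = T.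
Proof.
move=> sumS sumT; apply: fpsP => N.
have [s sA sS] := sumS N; have [t tA tT] := sumT N.
have stA : {subset undup (s ++ t) <= A}.
  by move=> i; rewrite mem_undup mem_cat => /orP[/sA | /tA].
rewrite -(sS (undup (s ++ t))) ?undup_uniq //; first last.
  by move=> i si; rewrite mem_undup mem_cat si.
by rewrite tT ?undup_uniq // => i ti; rewrite mem_undup mem_cat ti orbT.
Qed.

Definition fps_sum_eq (R : comUnitRingType) (I J : eqType)
    (A : {pred I}) (F : I -> fps R) (B : {pred J}) (G : J -> fps R) : Prop :=
  exists S : fps R, fps_has_sum A F S /\ fps_has_sum B G S.

Definition qpoch (K : comUnitRingType) (a q : K) (n : nat) : K :=
  \prod_(i < n) (1 - a * q ^+ i).

(* Partitions are lists of parts in decreasing order. *)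
Definition distinct_partition (l : seq nat) : bool :=
  sorted gtn l && all (fun a => 0 < a)%N l.

Definition num_odd (l : seq nat) : nat := count odd l.
Definition num_even (l : seq nat) : nat := count (fun a => ~~ odd a) l.

(* Used only for consecutive parts [a > b], so [a - b] is not truncated. *)
Definition P4_step (a b : nat) : bool :=
  ((a - b) %% 4 ==
    if odd a != odd b then 3 else if odd a then 2 else 0)%N.

Definition P4 : {pred seq nat} := fun l =>
  [&& distinct_partition l, sorted P4_step l &
      (l == [::]) || (last 0%N l %% 4 \in [:: 1; 2])%N].

Definition P4e : {pred seq nat} := fun l => (l \in P4) && ~~ odd (size l).
Definition P4o : {pred seq nat} := fun l => (l \in P4) && odd (size l).

(* Main.v *)
(* Let [a] be the smallest part of [l] in P_4. Deleting it and lowering every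
   other part by [a + 1] ([a] odd) or [a + 2] ([a] even) gives an arbitrary
   element of P_4 with one part fewer, and [a] is an arbitrary number congruent
   to 1 or 2 mod 4. Hence the generating function of the partitions with [n + 1]
   parts is that for [n] parts times
   [(x q^(2n+1) + y q^(4n+2)) / (1 - q^(4(n+1)))], so that the partitions with
   [n] parts account for exactly the [n]-th term of the third series.
   Restricting to parts [a < 4M] turns each geometric series into
   [(1 - q^(4(n+1)M)) / (1 - q^(4(n+1)))], an exact finite identity that does
   not alter the coefficients below [q^M]. *)
Require Import Defs.
From mathcomp Require Import all_boot all_order all_algebra.
From mathcomp Require Import zify ring.

Set Implicit Arguments.
Unset Strict Implicit.
Unset Printing Implicit Defensive.

Import GRing.Theory.
Local Open Scope ring_scope.

(** * Inserting and removing the smallest part *)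

Lemma last_le_sorted_gtn (l : seq nat) :
  sorted gtn l -> {in l, forall b, (last 0 l <= b)%N}.
Proof.
case: l => // a l /= sl b; elim: l a sl b => [|c l IH] a /=.
  by move=> _ b; rewrite inE => /eqP ->.
case/andP=> ca pl b; rewrite inE => /predU1P[-> | bl]; last exact: IH.
by apply: leq_trans (ltnW ca); apply: IH pl _ (mem_head _ _).
Qed.

Definition P4_rel (a b : nat) : bool := gtn a b && P4_step a b.

Definition P4_min (a : nat) : bool := (a %% 4 \in [:: 1; 2])%N.

Lemma P4E (l : seq nat) :
  (l \in P4) = sorted P4_rel l && ((l == [::]) || P4_min (last 0%N l)).
Proof.
rewrite -topredE /= /P4 /distinct_partition sorted_relI.
case: l => // a l; rewrite [a :: l == _]/= !orFb.
case gl: (sorted gtn _) => //=; case: (path P4_step a l); rewrite ?andbF //.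
rewrite -/(P4_min _); case ml: (P4_min _); rewrite ?andbF //= !andbT.
apply/(allP (s := a :: l)) => b bl.
apply: leq_trans (last_le_sorted_gtn (l := a :: l) gl bl).
by move: ml; rewrite /P4_min /=; case: (last a l).
Qed.

Definition P4_shift (a : nat) : nat := (a + (~~ odd a).+1)%N.

(* Raising every part by an even constant keeps parities and differences;
   the constant is chosen so that the old smallest part is allowed above [a]
   exactly when it is allowed as a smallest part. *)
Definition add_smallest (l : seq nat) (a : nat) : seq nat :=
  rcons (map (addn (P4_shift a)) l) a.

Lemma odd_P4_shift (a : nat) : odd (P4_shift a) = false.
Proof. by rewrite /P4_shift oddD; case: (odd a). Qed.

Lemma P4_rel_shift (c a b : nat) : ~~ odd c ->
  P4_rel (c + a) (c + b) = P4_rel a b.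
Proof.
by move=> /negPf ec; rewrite /P4_rel /P4_step /= ltn_add2l subnDl !oddD ec.
Qed.

(** The difference is $d+1$ for odd [a] and $d+2$ for even [a]; either way the step condition says
    $d\equiv1$ for odd [d] and $d\equiv2$ for even [d]. *)
Lemma P4_rel_smallest (a d : nat) : P4_min a ->
  P4_rel (P4_shift a + d) a = P4_min d.
Proof.
rewrite /P4_rel /P4_step /P4_min /P4_shift !inE /= !oddD /= => ha.
have -> : (a < a + (~~ odd a).+1 + d)%N by lia.
by case oa: (odd a); case od: (odd d) => /=; lia.
Qed.

(** For even [a] the difference is 0 or 3 modulo 4, so it cannot be 1. This keeps the subtraction
    that undoes an insertion from truncating. *)
Lemma P4_shift_le (a d : nat) : P4_rel d a -> (P4_shift a <= d)%N.
Proof.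
rewrite /P4_rel /P4_step /P4_shift /=.
by case: (odd a); case: (odd d) => /=; lia.
Qed.

Lemma P4_add_smallest (l : seq nat) (a : nat) :
  (add_smallest l a \in P4) = P4_min a && (l \in P4).
Proof.
rewrite !P4E /add_smallest last_rcons -size_eq0 size_rcons /= andbC.
case ma: (P4_min a) => //=.
case: l => [|b l] //=; rewrite rcons_path last_map P4_rel_smallest //.
rewrite path_map; congr (_ && _); apply: eq_path => u v /=.
by rewrite P4_rel_shift ?odd_P4_shift.
Qed.

Lemma P4_rcons_add_smallest (l : seq nat) (a : nat) : rcons l a \in P4 ->
  exists l' : seq nat, rcons l a = add_smallest l' a.
Proof.
move=> la; exists [seq (b - P4_shift a)%N | b <- l].
rewrite /add_smallest -map_comp map_id_in // => b bl /=; rewrite subnKC //.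
move: la; rewrite P4E sorted_relI => /andP[/andP[]].
case: l bl => // c l bl /=; rewrite !rcons_path => /andP[gl rl1] /andP[_ rl2] _.
(* Since the parts decrease, only the second smallest part has to be compared with the shift. *)
apply: leq_trans (last_le_sorted_gtn (l := c :: l) gl bl).
by apply: P4_shift_le; apply/andP.
Qed.

(** * Finite enumeration by number of parts *)

Definition smallest_parts (M : nat) : seq nat :=
  [seq a <- iota 0 (4 * M) | P4_min a].

(** The bound [4 * M] applies to each part when it is inserted, before later shifts. The choices are
    thus independent, and the generating function is an exact product. *)
Fixpoint P4_lists (n M : nat) : seq (seq nat) :=
  if n is k.+1 then
    [seq add_smallest l a | l <- P4_lists k M, a <- smallest_parts M]
  else [:: [::]].

Lemma P4_lists_P4 (n M : nat) (l : seq nat) :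
  l \in P4_lists n M -> l \in P4 /\ size l = n.
Proof.
elim: n l => [|n IH] l; first by rewrite inE => /eqP ->.
case/allpairsP => -[l' a] /= [/IH[Pl' sl'] + ->].
rewrite mem_filter P4_add_smallest => /andP[-> _].
by rewrite size_rcons size_map sl'.
Qed.

Lemma sumn_add_smallest (l : seq nat) (a : nat) :
  sumn (add_smallest l a) = (sumn l + P4_shift a * size l + a)%N.
Proof.
rewrite sumn_rcons; congr (_ + _)%N.
by elim: l => [|b l /= ->]; rewrite ?muln0 //=; lia.
Qed.

(** Both the smallest part and the sum of the reduced partition are at most the sum of [l], so the
    bound [M] survives each removal. *)
Lemma mem_P4_lists (M : nat) (l : seq nat) :
  l \in P4 -> (sumn l < M)%N -> l \in P4_lists (size l) M.
Proof.
move sl: (size l) => n; elim: n l sl => [|n IH] l; first by move/size0nil=> ->.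
case/lastP: l => // l a + Pl.
have [l' la] := P4_rcons_add_smallest Pl; rewrite la in Pl *.
move: Pl; rewrite P4_add_smallest sumn_add_smallest size_rcons size_map.
move=> /andP[ma Pl'] [sl'] ltM.
apply: (allpairs_f add_smallest); first by apply: IH => //; lia.
by rewrite mem_filter ma mem_iota; lia.
Qed.

Lemma uniq_P4_lists (n M : nat) : uniq (P4_lists n M).
Proof.
elim: n => //= n IH; apply: allpairs_uniq => //.
  by rewrite filter_uniq // iota_uniq.
move=> [l a] [l' a'] _ _ /= /rcons_inj[ll' aa']; move: ll'; rewrite aa'.
by move/(inj_map (@addnI _)) => ->.
Qed.

Lemma size_le_sumn_P4 (l : seq nat) : l \in P4 -> (size l <= sumn l)%N.
Proof.
case/andP => /andP[_ +] _; elim: l => //= a l IH /andP[a0 /IH].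
by lia.
Qed.

(** * Generating function for a fixed number of parts *)

Section GeneratingFunction.

Variables (K : comUnitRingType) (x y q : K).

Definition P4_weight (l : seq nat) : K :=
  x ^+ num_odd l * y ^+ num_even l * q ^+ sumn l.

Lemma P4_weight_add_smallest (l : seq nat) (a : nat) :
  P4_weight (add_smallest l a) =
  P4_weight l * ((if odd a then x else y) * q ^+ (P4_shift a * size l + a)).
Proof.
have odd_shift : odd \o addn (P4_shift a) =1 odd.
  by move=> b /=; rewrite oddD odd_P4_shift.
rewrite /P4_weight sumn_add_smallest /num_odd /num_even /add_smallest.
rewrite -cats1 !count_cat !count_map /= (eq_count odd_shift).
under [count (preim _ _) _]eq_count => b do rewrite [preim _ _ _](congr1 negb (odd_shift b)).
by case: (odd a) => /=; rewrite !(addn0, exprD); ring.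
Qed.

Lemma smallest_partsS (M : nat) :
  smallest_parts M.+1 = smallest_parts M ++ [:: (4 * M).+1; (4 * M).+2].
Proof.
rewrite /smallest_parts mulnS addnC iotaD filter_cat add0n /=; congr (_ ++ _).
have m4 i : P4_min (4 * M + i) = P4_min i by rewrite /P4_min mulnC modnMDl.
by rewrite -(addn0 (4 * M)%N) -!addnS !m4.
Qed.

(** Raising [a] by 4 raises the exponent by $4(n+1)$, so odd and even [a] give two geometric sums,
    starting at 1 and 2. The denominator is cleared because it need not be invertible in [K]. *)
Lemma sum_smallest_parts (n M : nat) :
  (1 - q ^+ (4 * n.+1)) * (\sum_(a <- smallest_parts M)
     (if odd a then x else y) * q ^+ (P4_shift a * n + a)) =
  (1 - q ^+ (4 * n.+1 * M)) * (x * q ^+ (2 * n + 1) + y * q ^+ (4 * n + 2)).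
Proof.
elim: M => [|M IH]; first by rewrite big_nil muln0 subrr mulr0 mul0r.
rewrite smallest_partsS big_cat mulrDr IH !big_cons big_nil /= addr0 /P4_shift /=.
rewrite !oddM /=.
have -> : (((4 * M).+1 + 1) * n + (4 * M).+1 = 4 * n.+1 * M + (2 * n + 1))%N by lia.
have -> : (((4 * M).+2 + 2) * n + (4 * M).+2 = 4 * n.+1 * M + (4 * n + 2))%N by lia.
rewrite [(4 * n.+1 * M.+1)%N]mulnS; move: (4 * n.+1)%N (2 * n + 1)%N (4 * n + 2)%N => c d e.
by rewrite !(exprD q (c * M)) (exprD q c); ring.
Qed.

Lemma qpochS (a b : K) (n : nat) : qpoch a b n.+1 = qpoch a b n * (1 - a * b ^+ n).
Proof. by rewrite /qpoch big_ord_recr. Qed.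

Lemma sum_P4_lists (n M : nat) : x \is a GRing.unit ->
  qpoch (q ^+ 4) (q ^+ 4) n * (\sum_(l <- P4_lists n M) P4_weight l) =
  qpoch (- y * q / x) (q ^+ 2) n * x ^+ n * q ^+ (n ^ 2) *
  \prod_(j < n) (1 - q ^+ (4 * j.+1 * M)).
Proof.
move=> Ux; elim: n => [|n IH].
  by rewrite /qpoch !big_ord0 big_seq1 /P4_weight !expr0 !mulr1.
rewrite [P4_lists _ _]/= big_allpairs_dep.
(* As every [l] has [n] parts, the sum over [a] does not depend on [l] and factors out. *)
under eq_big_seq => l /P4_lists_P4[_ sl].
  under eq_bigr do rewrite P4_weight_add_smallest sl.
  rewrite -big_distrr; over.
rewrite /= -big_distrl !qpochS mulrACA IH.
rewrite -exprM -exprD -mulnS sum_smallest_parts big_ord_recr.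
have -> : (n.+1 ^ 2 = n ^ 2 + (2 * n + 1))%N by rewrite -!mulnn; lia.
have -> : (4 * n + 2 = (2 * n + 1) + (2 * n + 1))%N by lia.
rewrite -exprM [x ^+ n.+1]exprSr.
(* Extracting $xq^{2n+1}$, with $x$ invertible, leaves the next factor of $(-yq/x;q^2)_{n+1}$. *)
have -> : x * q ^+ (2 * n + 1) + y * q ^+ (2 * n + 1 + (2 * n + 1)) =
  (1 - - y * q / x * q ^+ (2 * n)) * x * q ^+ (2 * n + 1).
  rewrite mulrBl mul1r [_ / x * _]mulrAC divrK //.
  by move: (2 * n)%N => m; rewrite !exprD; ring.
rewrite /= (exprD q (n ^ 2)).
by move: (n ^ 2)%N (2 * n + 1)%N (2 * n)%N (4 * n.+1 * M)%N => *; ring.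
Qed.

End GeneratingFunction.

(** * Passage to infinite sums of power series *)

Section FormalPowerSeries.

Variable R : comUnitRingType.
Implicit Types f : fps R.

Lemma coef_fps_sum (I : Type) (s : seq I) (P : pred I) (F : I -> fps R) (N : nat) :
  coefs (\sum_(i <- s | P i) F i) N = \sum_(i <- s | P i) coefs (F i) N.
Proof. exact: (big_morph (fun f => coefs f N)). Qed.

Lemma coef_fps_mulXn f (e N : nat) :
  coefs (f * fpsX R ^+ e) N = if (N < e)%N then 0 else coefs f (N - e).
Proof.
have mulX g n : coefs (g * fpsX R) n = if n is m.+1 then coefs g m else 0.
  case: n => [|n]; first by rewrite [LHS]big_ord1 mulr0.
  rewrite [LHS]big_ord_recr big_ord_recr /= subnn mulr0 addr0 subSnn mulr1.
  rewrite big1 ?add0r // => i _; rewrite subSn ?eqSS; last exact: ltnW.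
  by rewrite subn_eq0 leqNgt ltn_ord mulr0.
elim: e N => [|e IH] N; first by rewrite expr0 mulr1 subn0.
by rewrite exprSr mulrA mulX; case: N => // N; rewrite IH ltnS subSS.
Qed.

(** This discards the truncation factors and, at [N = 0], shows that the denominators are
    invertible. *)
Lemma coef_fps_mul_prod1BXn f (n N : nat) (e : nat -> nat) :
  (forall j, N < e j)%N ->
  coefs (f * \prod_(j < n) (1 - fpsX R ^+ e j)) N = coefs f N.
Proof.
move=> ltNe; elim: n => [|n IH]; first by rewrite big_ord0 mulr1.
rewrite big_ord_recr [X in f * X]/= mulrA mulrBr mulr1.
have coefB g h : coefs (g - h) N = coefs g N - coefs h N :> R by [].
by rewrite coefB coef_fps_mulXn ltNe subr0.
Qed.

(** Enlarging [s0] inside [A] only adds terms whose coefficient at [N] vanishes. *)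
Lemma fps_has_sumP (I : eqType) (A : {pred I}) (F : I -> fps R) (S : fps R) :
  (forall N : nat, exists s0 : seq I,
    [/\ uniq s0, {subset s0 <= A},
        forall i, i \in A -> i \notin s0 -> coefs (F i) N = 0
      & coefs (\sum_(i <- s0) F i) N = coefs S N]) ->
  fps_has_sum A F S.
Proof.
move=> sumF N; have [s0 [us0 s0A F0 <-]] := sumF N.
exists s0 => // s us sA s0s; rewrite !coef_fps_sum (bigID (mem s0)) /=.
rewrite [X in _ + X]big_seq_cond [X in _ + X]big1 ?addr0; last first.
  by move=> i /andP[/sA]; apply: F0.
rewrite -big_filter; apply/perm_big/uniq_perm; rewrite ?filter_uniq //.
by move=> i; rewrite mem_filter andb_idr // => /s0s.
Qed.

Variables x0 y0 : R.
Hypothesis x0_unit : x0 \is a GRing.unit.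

Let x : fps R := fpsC x0.
Let y : fps R := fpsC y0.
Let q : fps R := fpsX R.

Definition P4_term (n : nat) : fps R :=
  qpoch (- y * q / x) (q ^+ 2) n * x ^+ n * q ^+ (n ^ 2)
    / qpoch (q ^+ 4) (q ^+ 4) n.

Lemma coef_P4_term_eq0 (n N : nat) : (N < n)%N -> coefs (P4_term n) N = 0.
Proof.
move=> ltNn; rewrite /P4_term mulrAC coef_fps_mulXn ifT //.
by apply: (leq_trans ltNn); rewrite -mulnn leq_pmulr // (leq_ltn_trans _ ltNn).
Qed.

Lemma coef_P4_term (n N M : nat) : (N < M)%N ->
  coefs (P4_term n) N = coefs (\sum_(l <- P4_lists n M) P4_weight x y q l) N.
Proof.
move=> ltNM; have Ux : x \is a GRing.unit by rewrite fps_unitE.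
have Uq : qpoch (q ^+ 4) (q ^+ 4) n \is a GRing.unit.
  rewrite fps_unitE /qpoch -[\prod_(i < n) _]mul1r.
  under eq_bigr do rewrite -exprM -exprD -mulnS.
  by rewrite (coef_fps_mul_prod1BXn _ _ (e := fun j => (4 * j.+1)%N)) //= unitr1.
have := sum_P4_lists y q n M Ux => /(canRL (mulKr Uq)) ->.
rewrite mulrA [_^-1 * _]mulrC -/(P4_term n).
rewrite (coef_fps_mul_prod1BXn _ _ (e := fun j => (4 * j.+1 * M)%N)) // => j.
by apply: leq_trans ltNM _; rewrite leq_pmull.
Qed.

(** The map [r] lists the allowed numbers of parts, so one argument covers all three identities.
    Injectivity keeps the enumerations for different [n] disjoint. *)
Lemma P4_sum_eq (A : {pred seq nat}) (r : nat -> nat) (G : nat -> fps R) :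
  injective r -> (forall n, n <= r n)%N ->
  (forall l, l \in A <-> l \in P4 /\ exists n, size l = r n) ->
  (forall n, G n = P4_term (r n)) ->
  fps_sum_eq A (P4_weight x y q) predT G.
Proof.
move=> rI ler AE GE.
(* Stopping at $n=N$ is enough: for $n>N$ the term has order at least $r(n)\ge n>N$. *)
exists (FPS (fun N => coefs (\sum_(n <- iota 0 N.+1) G n) N)); split.
  apply: fps_has_sumP => N.
  exists [seq l | n <- iota 0 N.+1, l <- P4_lists (r n) N.+1]; split.
  - apply: allpairs_uniq_dep => [|n _|]; first exact: iota_uniq.
      exact: uniq_P4_lists.
    move=> u v /allpairsPdep[n [l [_ ln ->]]] /allpairsPdep[m [k [_ km ->]]] /= lk.
    move: ln km; rewrite lk => /P4_lists_P4[_ sn] /P4_lists_P4[_]; rewrite sn => /rI nm.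
    by rewrite nm.
  - move=> _ /allpairsPdep[n [l [_ /P4_lists_P4[Pl sl] ->]]].
    by apply/AE; split => //; exists n.
  (* If [sumn l <= N], then $n\le r(n)\le|\lambda|\le N$ and [l] would have been listed. *)
  - move=> l /AE[Pl [n sl]] lN; rewrite coef_fps_mulXn ifT // ltnNge.
    apply: contra lN => leN; apply/allpairsPdep; exists n, l; split => //.
      rewrite mem_iota /= add0n ltnS (leq_trans (ler n)) // -sl.
      exact: leq_trans (size_le_sumn_P4 Pl) leN.
    by rewrite -sl mem_P4_lists.
  rewrite big_allpairs_dep /= !coef_fps_sum; apply: eq_bigr => n _.
  by rewrite GE (@coef_P4_term _ _ N.+1).
apply: fps_has_sumP => N; exists (iota 0 N.+1); split => // [|n _].
  exact: iota_uniq.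
rewrite mem_iota /= add0n ltnS -ltnNge GE => ltNn.
exact/coef_P4_term_eq0/(leq_trans ltNn).
Qed.

End FormalPowerSeries.

Theorem theorem3p4 (R : comUnitRingType) (x0 y0 : R)
    (hx : x0 \is a GRing.unit) :
  let x : fps R := fpsC x0 in
  let y : fps R := fpsC y0 in
  let q : fps R := fpsX R in
  let w : seq nat -> fps R :=
    fun l => x ^+ num_odd l * y ^+ num_even l * q ^+ sumn l in
  [/\ fps_sum_eq P4e w predT (fun n : nat =>
        qpoch (- y * q / x) (q ^+ 2) (2 * n) * x ^+ (2 * n)
          * q ^+ (4 * n ^ 2) / qpoch (q ^+ 4) (q ^+ 4) (2 * n)),
      fps_sum_eq P4o w predT (fun n : nat =>
        qpoch (- y * q / x) (q ^+ 2) (2 * n + 1) * x ^+ (2 * n + 1)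
          * q ^+ (4 * n ^ 2 + 4 * n + 1)
          / qpoch (q ^+ 4) (q ^+ 4) (2 * n + 1))
    & fps_sum_eq P4 w predT (fun n : nat =>
        qpoch (- y * q / x) (q ^+ 2) n * x ^+ n
          * q ^+ (n ^ 2) / qpoch (q ^+ 4) (q ^+ 4) n)].
Proof.
move=> x y q w; split.
- apply: (P4_sum_eq hx (r := muln 2)) => [m n||l|n]; try lia.
    rewrite [l \in P4e]/(_ && _); split=> [/andP[-> ev]|[-> [n ->]]].
      by split=> //; exists (size l)./2; lia.
    by rewrite oddM.
  by rewrite /P4_term expnMn.
- apply: (P4_sum_eq hx (r := fun n => 2 * n + 1)%N) => [m n||l|n]; try lia.
    rewrite [l \in P4o]/(_ && _); split=> [/andP[-> od]|[-> [n ->]]].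
      by split=> //; exists (size l)./2; lia.
    by rewrite oddD oddM.
  rewrite /P4_term (_ : (2 * n + 1) ^ 2 = 4 * n ^ 2 + 4 * n + 1)%N //.
  by rewrite -!mulnn; lia.
- apply: (P4_sum_eq hx (r := id)) => // l.
  by split=> [Pl|[]//]; split=> //; exists (size l).
Qed.
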